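(* Let $G=(V,E)$ be a non-bipartite, finite, simple, connected graph with $n=|V|$, and let $\lambda_1^\Theta\le\lambda_2^\Theta\le\dots\le\lambda_n^\Theta$ be the eigenvalues of its combinatorial signless Laplacian $\Theta=D+A$. For $1\le k\le n$, $$\lambda_k^\Theta\ge\frac{k\,\mathscr K(G)}{n}\ge\frac{k}{(\mathrm{diam}(G)+1)\,n}.$$
   Context: Graphs are undirected and unweighted; $A$ is the adjacency matrix, $D$ the diagonal degree matrix, $\mathrm{diam}(G)$ the graph diameter. The graph parameter $\mathscr K(G)$ is $$\mathscr K(G):=\min\left\{\frac{\sum_{(v,u)\in E}|f(v)+f(u)|^2}{\max_{y\in V}|f(y)|^2}\ :\ f\colon V\to\mathbb R,\ \min_{y\in V}f(y)<0<\max_{y\in V}f(y)\right\},$$ where the sum counts each edge once. *)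

(* Defs.v *)
From HB Require Import structures.
From mathcomp Require Import all_boot all_order all_algebra.
From mathcomp Require Import all_classical all_reals all_analysis.
From mathcomp Require Import ring lra.

Set Implicit Arguments.
Unset Strict Implicit.
Unset Printing Implicit Defensive.

Import Order.TTheory GRing.Theory Num.Theory.
Import numFieldNormedType.Exports.

Local Open Scope ring_scope.

Record sgraph := SGraph {
  vertex :> finType;
  adj : rel vertex;
  adj_sym : symmetric adj;
  adj_irrefl : irreflexive adj
}.

Definition connected_graph (G : sgraph) := forall x y : G, connect (@adj G) x y.

Definition bipartite (G : sgraph) :=
  exists c : G -> bool, forall x y : G, adj x y -> c x != c y.

Definition edges (G : sgraph) : {set {set G}} :=
  [set [set p.1; p.2] | p : G * G & adj p.1 p.2].

Definition deg (G : sgraph) (x : G) : nat := #|[set y | adj x y]|.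

Definition walk_of_length (G : sgraph) (x y : G) (l : nat) : bool :=
  [exists p : l.-tuple G, path (@adj G) x p && (last x p == y)].

(* A shortest walk visits no vertex twice, so its length is below #|G|; the
   junk value #|G| is returned exactly when y is not reachable from x. *)
Definition dist (G : sgraph) (x y : G) : nat :=
  find (walk_of_length x y) (iota 0 #|G|).

Lemma dist_le_size (G : sgraph) (x : G) (p : seq G) :
  path (@adj G) x p -> (dist x (last x p) <= size p)%N.
Proof.
move=> xp; rewrite leqNgt; apply/negP => lt_p.
have pG : (size p < #|G|)%N.
  by apply: leq_trans lt_p _; rewrite -[leqRHS](size_iota 0) find_size.
have := before_find 0%N lt_p; rewrite nth_iota// add0n => /negbT/negP; apply.
by apply/existsP; exists (in_tuple p); rewrite xp eqxx.
Qed.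

Lemma walk_of_length_dist (G : sgraph) (x y : G) :
  connect (@adj G) x y -> walk_of_length x y (dist x y).
Proof.
move=> /connectP[_ /shortenP[p xp Up _] ->].
have pG : (size p < #|G|)%N.
  by have /card_uniqP/= := Up; move=> <-; exact: max_card.
have wG : has (walk_of_length x (last x p)) (iota 0 #|G|).
  apply/hasP; exists (size p); first by rewrite mem_iota.
  by apply/existsP; exists (in_tuple p); rewrite xp eqxx.
have := nth_find 0%N wG; rewrite nth_iota ?add0n//.
by rewrite -[ltnRHS](size_iota 0) -has_find.
Qed.

Definition diam (G : sgraph) : nat := \max_(x : G) \max_(y : G) dist x y.

Section Matrices.
Variables (R : realType) (G : sgraph).

Definition adj_mx : 'M[R]_#|G| :=
  \matrix_(i, j) (adj (enum_val i) (enum_val j))%:R.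

Definition deg_mx : 'M[R]_#|G| :=
  diag_mx (\row_i (deg (enum_val i))%:R).

Definition signless_laplacian : 'M[R]_#|G| := deg_mx + adj_mx.

(* The eigenvalues are listed with multiplicity, in nondecreasing order. *)
Definition ordered_spectrum n (A : 'M[R]_n) (s : n.-tuple R) :=
  sorted <=%R s /\ char_poly A = \prod_(x <- s) ('X - x%:P).

End Matrices.

Section ScrK.
Variables (R : realType) (G : sgraph).
Implicit Types f g : G -> R.

(* An edge is the set of its two endpoints, so the inner sum is f v + f u. *)
Definition edge_energy f : R := \sum_(S in edges G) `|\sum_(x in S) f x| ^+ 2.

Definition max_sqr f : R := \big[Num.max/0]_(y : G) `|f y| ^+ 2.

(* Starting both iterations at 0 affects neither strict comparison with 0. *)
Definition sign_changing f : Prop :=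
  \big[Num.min/0]_(y : G) f y < 0 < \big[Num.max/0]_(y : G) f y.

Definition scrK : R :=
  inf [set edge_energy f / max_sqr f | f in sign_changing]%classic.

End ScrK.

Lemma continuous_sum (R : realType) (T : topologicalType) (I : Type) (r : seq I)
    (P : pred I) (F : I -> T -> R) : (forall i, P i -> continuous (F i)) ->
  continuous (fun x => \sum_(i <- r | P i) F i x).
Proof.
move=> cF x.
have c0 := @cvg_big R I +%R 0 P (@add_continuous R) T (nbhs x) r F (fun i => F i x) _.
by apply: c0 => i Pi; exact: cF.
Qed.

Lemma continuous_norm_sqr (R : realType) (T : topologicalType) (F : T -> R) :
  continuous F -> continuous (fun x => `|F x| ^+ 2).
Proof. by move=> cF x; apply: cvgM; exact: (cvg_norm (cF x)). Qed.

Section ScrKTheory.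
Variables (R : realType) (G : sgraph).
Implicit Types f g : G -> R.

Lemma sign_changingP f :
  sign_changing f <-> (exists x, f x < 0) /\ (exists y, 0 < f y).
Proof.
split=> [/andP[lt0 gt0]|[[x fx] [y fy]]].
  split; apply: contrapT => nex; [move: lt0|move: gt0].
    rewrite ltNge => /negP; apply.
    elim/big_ind: _ => [//|a b a0 b0|z _]; first by rewrite le_min a0.
    by rewrite leNgt; apply/negP => fz; apply: nex; exists z.
  rewrite ltNge => /negP; apply.
  elim/big_ind: _ => [//|a b a0 b0|z _]; first by rewrite ge_max a0.
  by rewrite leNgt; apply/negP => fz; apply: nex; exists z.
apply/andP; split.
  by apply: le_lt_trans fx; rewrite (bigD1 x)//= ge_min lexx.
by apply: lt_le_trans fy _; rewrite (bigD1 y)//= le_max lexx.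
Qed.

Lemma edgesP (S : {set G}) :
  reflect (exists2 p : G * G, adj p.1 p.2 & S = [set p.1; p.2]%SET) (S \in edges G).
Proof. by apply: (iffP imsetP) => -[p]; rewrite ?inE => ep ->; exists p; rewrite ?inE. Qed.

Lemma sum_edge f (x y : G) : adj x y -> \sum_(z in [set x; y]%SET) f z = f x + f y.
Proof.
move=> exy; have xy : x != y by apply: contraTneq exy => ->; rewrite adj_irrefl.
by rewrite big_setU1 ?inE//= big_set1.
Qed.

Lemma max_sqr_ge f x : `|f x| ^+ 2 <= max_sqr f.
Proof. by rewrite /max_sqr (bigD1 x)//= le_max lexx. Qed.

Lemma max_sqr_attained f : (exists x, f x != 0) ->
  exists2 x, f x != 0 & max_sqr f = `|f x| ^+ 2 /\ forall y, `|f y| <= `|f x|.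
Proof.
move=> [x0 fx0]; have [x xmax] : exists x, forall y, `|f y| <= `|f x|.
  have [x _ xm] := Order.TotalTheory.arg_maxP (fun x => `|f x|) (isT : xpredT x0).
  by exists x => y; apply: xm.
exists x; first by rewrite -normr_gt0 (lt_le_trans _ (xmax x0))// normr_gt0.
split=> //; apply/le_anti; rewrite max_sqr_ge andbT /max_sqr.
elim/big_ind: _ => [|a b a0 b0|y _]; first by rewrite sqr_ge0.
  by rewrite ge_max a0.
by rewrite lerXn2r ?nnegrE.
Qed.

Lemma edge_energyZ a f : edge_energy (fun x => a * f x) = a ^+ 2 * edge_energy f.
Proof.
rewrite mulr_sumr; apply: eq_bigr => S _.
by rewrite -mulr_sumr normrM exprMn real_normK ?num_real.
Qed.

Lemma edge_energy_ge0 f : 0 <= edge_energy f.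
Proof. by apply: sumr_ge0 => S _; rewrite sqr_ge0. Qed.

Lemma edge_energy_min_box (i : G) : exists2 f : G -> R,
  f i = 1 /\ (forall j, `|f j| <= 1) &
  forall g, g i = 1 -> (forall j, `|g j| <= 1) -> edge_energy f <= edge_energy g.
Proof.
pose T (_ : G) : topologicalType := R.
pose A (j : G) : set R := if j == i then `[1, 1]%classic else `[-1, 1]%classic.
have cA : compact [set f : prod_topology T | forall j, A j (f j)]%classic.
  apply: (@tychonoff G T A) => j; rewrite /A.
  by case: ifP => _; exact: (@segment_compact R).
have AE (f : G -> R) : (forall j, A j (f j)) <-> f i = 1 /\ forall j, `|f j| <= 1.
  split=> [Af|[fi fj] j].
    have fi : f i = 1.
      by move: (Af i); rewrite /A eqxx/= in_itv/= => /le_anti.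
    split=> // j; have := Af j; rewrite /A; case: eqP => [->|_] /=.
      by rewrite fi normr1.
    by rewrite in_itv/= ler_norml.
  rewrite /A; case: eqP => [->|_]/=; first by rewrite in_itv/= fi lexx.
  by rewrite in_itv/= -ler_norml fj.
have contE : continuous (@edge_energy R G : prod_topology T -> R).
  apply: continuous_sum => S _; apply: continuous_norm_sqr.
  by apply: continuous_sum => x _; exact: (@proj_continuous G T x).
have A0 : ([set f : prod_topology T | forall j, A j (f j)] !=set0)%classic.
  by exists (fun=> 1); apply/AE; split => // j; rewrite normr1.
have [f /[!inE]/AE Af fmin] := compact_EVT_min A0 cA (continuous_subspaceT contE).
by exists f => // g gi gj; apply: fmin; rewrite inE; apply/AE.
Qed.

Lemma sign_changing_improve f (i j : G) : adj i j -> f i = 1 ->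
  (forall x, 0 <= f x <= 1) ->
  exists2 g : G -> R, sign_changing g & g i = 1 /\ (forall x, `|g x| <= 1) /\
    edge_energy g <= edge_energy f.
Proof.
move=> eij fi f01.
have ij : i != j by apply: contraTneq eij => ->; rewrite adj_irrefl.
pose N : R := #|edges G|%:R; pose e := (N + 1)^-1.
have N0 : 0 <= N by rewrite ler0n.
have e0 : 0 < e by rewrite invr_gt0; lra.
have eE : (N + 1) * e = 1 by rewrite mulfV//; lra.
have e1 : e <= 1 by nra.
pose t := if f j == 0 then e else f j.
have t0 : 0 < t <= 1.
  rewrite /t; case: ifPn => fj; first by rewrite e0.
  by have /andP[] := f01 j; rewrite lt_neqAle eq_sym fj => -> ->.
pose g x := if x == j then - t else f x.
have gi : g i = 1 by rewrite /g (negPf ij).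
exists g.
  apply/sign_changingP; split; first by exists j; rewrite /g eqxx; lra.
  by exists i; rewrite gi.
split=> //; split.
  move=> x; rewrite /g; case: eqP => _; rewrite ler_norml; first by lra.
  by have := f01 x; lra.
have gE x : x != j -> g x = f x by rewrite /g => /negPf ->.
have gj : g j = - t by rewrite /g eqxx.
have other (S : {set G}) : S \in edges G ->
    `|\sum_(x in S) g x| ^+ 2 <= `|\sum_(x in S) f x| ^+ 2 + (f j == 0)%:R * e ^+ 2.
  case/edgesP => -[x y]/= exy ->; rewrite !sum_edge// !real_normK ?num_real//.
  have tE : (t = f j /\ (f j == 0)%:R = 0 :> R) \/
            (t = e /\ (f j == 0)%:R = 1 :> R /\ f j = 0).
    by rewrite /t; case: eqP => fj; [right|left].
  have xy : x != y by apply: contraTneq exy => ->; rewrite adj_irrefl.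
  have fx := f01 x; have fy := f01 y; have fj := f01 j.
  have [xj|xj] := eqVneq x j; [|have [yj|yj] := eqVneq y j].
  - subst x; have yj : y != j by rewrite eq_sym.
    rewrite gj (gE y yj).
    by case: tE => [[-> ->]|[-> [-> ->]]]; nra.
  - subst y; rewrite gj (gE x)//.
    by case: tE => [[-> ->]|[-> [-> ->]]]; nra.
  - by rewrite !gE//; case: tE => [[_ ->]|[_ [-> _]]]; nra.
have ijE : [set i; j]%SET \in edges G by apply/edgesP; exists (i, j).
have eijb : `|\sum_(x in [set i; j]%SET) g x| ^+ 2 <=
   `|\sum_(x in [set i; j]%SET) f x| ^+ 2 - (f j == 0)%:R * (e - e ^+ 2).
  rewrite !sum_edge// !real_normK ?num_real// gi gj fi /t.
  by case: eqP => [->|_]; rewrite ?mul1r ?mul0r; have := f01 j; nra.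
rewrite /edge_energy (bigD1 _ ijE)/= [leRHS](bigD1 _ ijE)/=.
set Sg := \sum_(S in edges G | _) `|\sum_(x in S) g x| ^+ 2.
set Sf := \sum_(S in edges G | _) `|\sum_(x in S) f x| ^+ 2.
have SgSf : Sg <= Sf + (f j == 0)%:R * e ^+ 2 * N.
  have -> : (f j == 0)%:R * e ^+ 2 * N = \sum_(S in edges G) (f j == 0)%:R * e ^+ 2.
    by rewrite sumr_const mulr_natr.
  have : Sg <= \sum_(S in edges G | S != [set i; j]%SET)
      (`|\sum_(x in S) f x| ^+ 2 + (f j == 0)%:R * e ^+ 2).
    by apply: ler_sum => S /andP[SE _]; exact: other.
  move=> /le_trans; apply.
  rewrite big_split/= lerD2l [leRHS](bigD1 _ ijE)/= lerDr.
  by rewrite mulr_ge0// sqr_ge0.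
move: eijb SgSf; case: eqP => _; rewrite ?mul1r ?mul0r; nra.
Qed.

(* The infimum defining scrK is a minimum. *)
Lemma scrK_attained : connected_graph G -> ~ bipartite G ->
  exists2 f : G -> R, sign_changing f & edge_energy f / max_sqr f = scrK R G.
Proof.
move=> conn nbip.
have nbr (i : G) : exists j, adj i j.
  apply: contrapT => no; apply: nbip; exists xpredT => x y exy.
  suff only z : z = i by case: no; exists y; rewrite -(only x).
  have /connectP[[|w p]/=] := conn i z; first by [].
  by case/andP => iw; case: no; exists w.
have [x0 _] : exists x0 : G, True.
  by apply: contrapT => no; apply: nbip; exists xpredT => x; case: no; exists x.
have /boolp.choice[m mmin] : forall i, exists f : G -> R,
    (f i = 1 /\ forall j, `|f j| <= 1) /\
    forall g, g i = 1 -> (forall j, `|g j| <= 1) -> edge_energy f <= edge_energy g.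
  by move=> i; have [f] := edge_energy_min_box i; exists f.
have [i _ imin] := Order.TotalTheory.arg_minP (fun i => edge_energy (m i)) (isT : xpredT x0).
have lower g : sign_changing g -> edge_energy (m i) <= edge_energy g / max_sqr g.
  move=> /sign_changingP[[x gx] _].
  have [|z gz [-> gmax]] := @max_sqr_attained g; first by exists x; rewrite lt_eqF.
  have [_ zmin] := mmin z; apply: le_trans (imin z isT) _.
  have := zmin (fun x => (g z)^-1 * g x); rewrite edge_energyZ mulVf//.
  rewrite exprVn mulrC real_normK ?num_real//; apply=> // y.
  by rewrite normrM normfV mulrC ler_pdivrMr ?normr_gt0// mul1r.
have [[mi mi1] imin'] := mmin i.
have max1 g : g i = 1 -> (forall x, `|g x| <= 1) -> max_sqr g = 1.
  move=> gi g1; apply/le_anti/andP; split; last first.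
    by have := max_sqr_ge g i; rewrite gi normr1 expr1n.
  rewrite /max_sqr; elim/big_ind: _ => [//|a b a0 b0|y _].
    by rewrite ge_max a0.
  by rewrite expr_le1.
have [h hs [hi [h1 hE]]] : exists2 h : G -> R, sign_changing h &
    h i = 1 /\ (forall x, `|h x| <= 1) /\ edge_energy h <= edge_energy (m i).
  have [neg|nneg] := pselect (exists x, m i x < 0).
    exists (m i) => //; apply/sign_changingP; split=> //.
    by exists i; rewrite mi.
  have m01 x : 0 <= m i x <= 1.
    rewrite (le_trans (ler_norm _) (mi1 x)) andbT leNgt.
    by apply/negP => mx; apply: nneg; exists x.
  by have [j ij] := nbr i; exact: sign_changing_improve ij mi m01.
exists h => //; apply/le_anti/andP; split; last first.
  by apply: ge_inf; [exists (edge_energy (m i)) => _ [g gs <-]; exact: lower|exists h].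
apply: lb_le_inf; first by exists (edge_energy h / max_sqr h), h.
move=> _ [g gs <-]; rewrite max1// divr1; exact: le_trans hE (lower g gs).
Qed.

End ScrKTheory.

(* Main.v *)
(* Let [P] be the orthogonal projection onto the span of the first [k]
   eigenvectors. Since [\tr P = k], some diagonal entry satisfies [P v v >= k / n].
   The row [f] of [P] at [v] has [f v = P v v] and energy at most [lam_k * P v v],
   while no function, sign-changing or not, has energy below [K * f v ^ 2]; hence
   [lam_k >= K * P v v]. For the second bound, the energy of a minimizer is
   estimated along a path joining a point [x] of maximal modulus to an edge whose
   endpoints are equally far from [x]; such an edge exists as [G] has an odd cycle.
   The eigenvectors are taken in [R[i]], so [f] is complex: its real and imaginary
   parts have energies that add up, and the real part alone carries [f v]. *)

Require Import Defs.
From mathcomp Require Import all_boot all_order all_algebra.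
From mathcomp Require Import perm spectral.
From mathcomp.real_closed Require Import complex.
From mathcomp Require Import all_classical all_reals all_analysis.
From mathcomp Require Import zify ring lra.

Set Implicit Arguments.
Unset Strict Implicit.
Unset Printing Implicit Defensive.

Import Order.TTheory GRing.Theory Num.Theory.

Local Open Scope ring_scope.

Local Notation Re := complex.Re.
Local Notation Im := complex.Im.

(** * Spectral theory of real symmetric matrices over [R[i]] *)

Lemma char_poly_conj (K : fieldType) n (P A : 'M[K]_n) :
  P \in unitmx -> char_poly (invmx P *m A *m P) = char_poly A.
Proof.
move=> uP; rewrite /char_poly.
have PI : map_mx polyC (invmx P) *m map_mx polyC P = 1%:M.
  by rewrite -map_mxM mulVmx// map_mx1.
have -> : char_poly_mx (invmx P *m A *m P) =
    map_mx polyC (invmx P) *m char_poly_mx A *m map_mx polyC P.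
  rewrite /char_poly_mx !map_mxM mulmxBr mulmxBl.
  by rewrite mul_mx_scalar -scalemxAl PI scalemx1.
by rewrite !det_mulmx mulrAC -det_mulmx PI det1 mul1r.
Qed.

Section ComplexSpectral.
Local Open Scope complex_scope.
Local Open Scope sesquilinear_scope.

Lemma real_symmetric_normalmx (R : rcfType) n (A : 'M[R]_n) :
  A^T = A -> map_mx (real_complex R) A \is normalmx.
Proof.
move=> As.
have AE : (map_mx (real_complex R) A)^t* = map_mx (real_complex R) A.
  by apply/matrixP => i j; rewrite !mxE -[in RHS]As mxE; exact: conjc_real.
by apply/normalmxP; rewrite AE.
Qed.

(** The spectral theorem provides some diagonal [d]; [d] and [s] list the roots of the same
    characteristic polynomial, hence agree up to a permutation. *)
Lemma unitary_diagonalization (R : rcfType) n (A : 'M[R]_n) (s : n.-tuple R) :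
  A^T = A ->
  char_poly A = \prod_(x <- s) ('X - x%:P) ->
  exists U : 'M[R[i]]_n, exists p : 'S_n, U \is unitarymx /\
    map_mx (real_complex R) A = U^t* *m diag_mx (\row_i (s`_(p i))%:C) *m U.
Proof.
move=> As chA.
have /orthomx_spectralP := real_symmetric_normalmx As.
set U := spectralmx _; set d := spectral_diag _ => AE.
have uU : U \is unitarymx by exact: spectral_unitarymx.
have : perm_eq [tuple d 0 i | i < n] [tuple (tnth s i)%:C | i < n].
  apply: prod_XsubC_eq.
  have := map_char_poly (real_complex R) A.
  rewrite chA AE char_poly_conj ?unitarymx_unit// char_poly_trig ?diag_mx_is_trig//.
  rewrite map_prod_XsubC big_tuple !big_map /= => E.
  rewrite [RHS]E; apply: eq_bigr => i _.
  by rewrite mxE eqxx.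
move=> /tuple_permP[p dE]; exists U, p; split=> //.
rewrite AE invmx_unitary//; congr (_ *m diag_mx _ *m _).
apply/rowP => i; rewrite mxE.
have := congr1 (fun t => nth 0 t i) dE.
by rewrite -!tnth_nth !tnth_mktuple (tnth_nth 0).
Qed.

Lemma conj_diag_mxE (C : numClosedFieldType) n (U : 'M[C]_n) (e : 'rV_n) v :
  (U^t* *m diag_mx e *m U) v v = \sum_i e 0 i * `|U i v| ^+ 2.
Proof.
rewrite mul_mx_diag mxE; apply: eq_bigr => i _; rewrite !mxE.
by rewrite normCK mulrAC mulrC [U i v * _]mulrC.
Qed.

(** For real [r], [Re ((a + b i) r (c - d i)) = r (a c + b d)]: the mixed terms are imaginary. *)
Lemma Re_hermitian_form (R : rcfType) n (A : 'M[R]_n) (z : 'rV[R[i]]_n) :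
  let x := map_mx (@Re R) z in let y := map_mx (@Im R) z in
  Re ((z *m map_mx (real_complex R) A *m z^t*) 0 0) =
  (x *m A *m x^T) 0 0 + (y *m A *m y^T) 0 0.
Proof.
move=> x y; rewrite !mxE raddf_sum -big_split /=; apply: eq_bigr => j _.
rewrite !mxE !mulr_suml raddf_sum -big_split /=; apply: eq_bigr => i _.
rewrite !mxE.
by case: (z 0 i) (z 0 j) => [a b] [c d] /=; ring.
Qed.

(* The row [x + i y] is the v-th row of the orthogonal projection onto the first
   [k] eigenvectors; [x 0 v] is the v-th diagonal entry, and these sum to [k]. *)
Lemma spectral_projection_row (R : realType) n (A : 'M[R]_n) (s : n.-tuple R) k :
  A^T = A -> ordered_spectrum A s -> (0 < k <= n)%N ->
  exists (v : 'I_n) (x y : 'rV[R]_n), k%:R <= n%:R * x 0 v /\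
    (x *m A *m x^T) 0 0 + (y *m A *m y^T) 0 0 <= s`_k.-1 * x 0 v.
Proof.
move=> As [s_sorted chA] /andP[k0 kn].
have [U [p [uU AE]]] := unitary_diagonalization As chA.
(* [p i < k] selects the eigenvectors, columns of [U^t*], that belong to the first [k] entries of
   [s]. *)
pose b : 'rV[R[i]]_n := \row_i (p i < k)%N%:R.
pose Z := U^t* *m diag_mx b *m U.
pose w v : R := Re (Z v v).
have ZE v : Z v v = (\sum_(i | (p i < k)%N) Re (`|U i v| ^+ 2))%:C.
  rewrite conj_diag_mxE rmorph_sum [RHS]big_mkcond; apply: eq_bigr => i _.
  rewrite mxE; case: ifP => _; rewrite ?mul0r// mul1r.
  by symmetry; apply: RRe_real; rewrite rpredX ?normr_real.
have wE v : w v = \sum_(i | (p i < k)%N) Re (`|U i v| ^+ 2) by rewrite /w ZE.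
(* The rows of [U] have norm one and [p] is a bijection, so exactly [k] rows contribute 1 each to
   the trace. *)
have sumw : \sum_v w v = k%:R.
  under eq_bigr do rewrite wE.
  rewrite exchange_big /= -[k in RHS]card_ord -sumr_const.
  have rowU i : \sum_v Re (`|U i v| ^+ 2) = 1.
    rewrite -raddf_sum.
    have /matrixP/(_ i i) := elimT unitarymxP uU; rewrite !mxE eqxx => E.
    rewrite (_ : \sum_v _ = 1)// -[RHS]E; apply: eq_bigr => v _.
    by rewrite !mxE normCK.
  rewrite (eq_bigr (fun=> 1)) => [|i _]; last exact: rowU.
  rewrite (reindex_inj (@perm_inj _ p^-1%g)) /=.
  under eq_bigl do rewrite permKV.
  by rewrite (big_ord_narrow kn).
have [v wv] : exists v, k%:R <= n%:R * w v.
  apply/existsP; apply: contraPT sumw; rewrite negb_exists => /forallP wlt.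
  have n0 : 0 < n%:R :> R by rewrite ltr0n (leq_trans k0).
  suff : \sum_v w v < k%:R by move=> /lt_eqF/eqP.
  have -> : k%:R = \sum_(v < n) k%:R / n%:R :> R.
    by rewrite sumr_const card_ord -[RHS]mulr_natl mulrCA mulfV ?mulr1// lt0r_neq0.
  apply: ltr_sum => [|v _]; last by rewrite ltr_pdivlMr// mulrC ltNge wlt.
  by apply/hasP; exists (Ordinal (leq_trans k0 kn)); rewrite ?mem_index_enum.
exists v, (map_mx (@Re R) (row v Z)), (map_mx (@Im R) (row v Z)).
have -> : map_mx (@Re R) (row v Z) 0 v = w v by rewrite 2!mxE.
split=> //; rewrite wE mulr_sumr.
rewrite -Re_hermitian_form.
have bb : (diag_mx b)^t* = diag_mx b.
  rewrite tr_diag_mx map_diag_mx; congr diag_mx; apply/rowP => i.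
  by rewrite !mxE; exact: conjc_nat.
have ZT : Z^t* = Z by rewrite /Z !trmx_mul !map_mxM trmxCK bb mulmxA.
have -> : (row v Z *m map_mx (real_complex R) A *m (row v Z)^t*) 0 0 =
    (Z *m map_mx (real_complex R) A *m Z^t*) v v.
  by rewrite -row_mul !mxE; apply: eq_bigr => j _; rewrite !mxE.
(* [Z] is idempotent and commutes with [A], so only the eigenvalues with [p i < k] survive. *)
have -> : Z *m map_mx (real_complex R) A *m Z^t* =
    U^t* *m diag_mx (\row_i (if (p i < k)%N then (s`_(p i))%:C else 0)) *m U.
  rewrite ZT AE /Z !mulmxA !(mulmxtVK _ uU) -[RHS]mulmxA -!mulmxA; congr (_ *m _).
  rewrite !mulmxA !mulmx_diag; congr (diag_mx _ *m _); apply/rowP => i; rewrite !mxE.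
  by case: ifP => _; rewrite ?mul0r// mul1r mulr1.
rewrite conj_diag_mxE raddf_sum big_mkcond [leRHS]big_mkcond /=.
apply: ler_sum => i _; rewrite mxE; case: ifP => pik; last by rewrite mul0r.
have -> : Re ((s`_(p i))%:C * `|U i v| ^+ 2) = s`_(p i) * Re (`|U i v| ^+ 2).
  by case: (`|U i v| ^+ 2) => a c /=; rewrite mul0r subr0.
apply: ler_wpM2r.
  by have := exprn_ge0 2 (normr_ge0 (U i v)); rewrite lecE => /andP[].
apply: (le_sorted_leq_nth 0 s_sorted); rewrite ?inE ?size_tuple //.
  by rewrite prednK.
by rewrite -ltnS prednK.
Qed.

End ComplexSpectral.

(** * Edges as pairs, shortest paths and equidistant edges *)

Lemma set2_eq (T : finType) (a b x y : T) : ([set a; b]%SET == [set x; y]%SET) =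
  ((a == x) && (b == y)) || ((a == y) && (b == x)).
Proof.
apply/eqP/idP => [E|/orP[]/andP[/eqP-> /eqP->]//]; last exact: finset.setUC.
have := set22 x y; have := set21 x y; rewrite -E.
have := set22 a b; have := set21 a b; rewrite {1 2}E !inE.
rewrite [x == a]eq_sym [x == b]eq_sym [y == a]eq_sym [y == b]eq_sym.
by case: (a == x) (a == y) (b == x) (b == y) => [] [] [] [].
Qed.

Section Graph.
Variable G : sgraph.
Implicit Types x y z : G.

Lemma adj_neq x y : adj x y -> x != y.
Proof. by apply: contraTneq => ->; rewrite adj_irrefl. Qed.

Lemma dist_le_diam x y : (dist x y <= diam G)%N.
Proof. by apply: leq_trans (leq_bigmax x); exact: leq_bigmax. Qed.

(** Removing loops from a walk of length [dist x y] cannot shorten it, by minimality. *)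
Lemma shortest_path x y : connect (@adj G) x y ->
  exists p, [/\ path (@adj G) x p, last x p = y, uniq (x :: p) & size p = dist x y].
Proof.
move=> /walk_of_length_dist/existsP[q /andP[]].
case/shortenP => p xp Up sub_pq /eqP lastp.
exists p; split => //; apply/eqP; rewrite eqn_leq -{2}lastp dist_le_size// andbT.
rewrite -[leqRHS](size_tuple q).
by apply: uniq_leq_size sub_pq; case/andP: Up.
Qed.

Lemma dist_adj x y z : connect (@adj G) x y -> adj y z -> (dist x z <= (dist x y).+1)%N.
Proof.
move=> /shortest_path[p [xp lastp _ <-]] yz.
have := @dist_le_size G x (rcons p z).
by rewrite rcons_path xp lastp yz last_rcons size_rcons; apply.
Qed.

(* Otherwise the parity of the distance to [x] would be a 2-colouring. *)
Lemma nonbipartite_equidistant_edge x : connected_graph G -> ~ bipartite G ->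
  exists y z, adj y z /\ dist x y = dist x z.
Proof.
move=> conn nbip; apply: contrapT => no; apply: nbip.
exists (fun y => odd (dist x y)) => y z yz; apply/eqP => oddE; apply: no; exists y, z.
(* Distances from [x] to adjacent vertices differ by at most one; equal parity makes them equal. *)
split=> //; have yz' := dist_adj (conn x y) yz.
have := dist_adj (conn x z) (etrans (adj_sym z y) yz); lia.
Qed.

(** * Edge energy as the quadratic form of [D + A] *)

Variable R : realType.
Implicit Type f : G -> R.

(** Each edge comes from exactly two ordered pairs, [(a, b)] and [(b, a)]. *)
Lemma edge_energyE f :
  2 * edge_energy f = \sum_x \sum_(y | adj x y) (f x + f y) ^+ 2.
Proof.
rewrite pair_big_dep /= /edge_energy (partition_big_imset
  (fun p : G * G => [set p.1; p.2]%SET)) /=.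
have -> : [set [set p.1; p.2]%SET | p : G * G in [pred p : G * G | adj p.1 p.2]] = edges G.
  by apply/setP => S; apply/imsetP/edgesP => -[p pE ->]; exists p; rewrite ?inE in pE *.
rewrite mulr_sumr; apply: eq_bigr => _ /edgesP[[a b] /= ab ->].
rewrite (bigD1 (a, b)) /=; last by rewrite unfold_in /= ab eqxx.
rewrite (bigD1 (b, a)) /=; last first.
  by rewrite unfold_in /= adj_sym ab finset.setUC eqxx xpair_eqE negb_and eq_sym adj_neq.
rewrite sum_edge// real_normK ?num_real// big1; last first.
  case=> c d /=.
  rewrite set2_eq !xpair_eqE => /andP[/andP[/andP[_ E] /negPf n1] /negPf n2].
  by rewrite n1 n2 in E.
by ring.
Qed.

(** Vertex [x] contributes [deg x * f x ^ 2] plus the products [f x * f y] over its neighbours;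
    adding the same sum with [x] and [y] exchanged completes the squares. *)
Lemma signless_laplacian_form (u : 'rV[R]_#|G|) :
  (u *m signless_laplacian R G *m u^T) 0 0 = edge_energy (fun x => u 0 (enum_rank x)).
Proof.
set f := fun x => _.
have rankP F : \sum_i F i = \sum_(x : G) F (enum_rank x) :> R.
  by rewrite (reindex (@enum_rank G))//; exact/onW_bij/enum_rank_bij.
apply: (@mulfI _ 2); first by rewrite pnatr_eq0.
pose S := \sum_x \sum_(y | adj x y) (f x * f x + f x * f y).
have -> : (u *m signless_laplacian R G *m u^T) 0 0 = S.
  rewrite mxE rankP; apply: eq_bigr => x _.
  rewrite !mxE rankP mulr_suml [RHS]big_split /= sumr_const.
  rewrite [X in _ = _ + X]big_mkcond (bigD1 x) //= [X in _ = _ + X](bigD1 x) //= !addrA.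
  rewrite !mxE !enum_rankK eqxx adj_irrefl /f addr0 mulr1n; congr (_ + _).
    by rewrite addr0 /deg cardsE mulrAC mulr_natr.
  apply: eq_bigr => y yx; rewrite !mxE !enum_rankK (inj_eq enum_rank_inj) (negPf yx).
  by rewrite mulr0n add0r adj_sym mulrAC mulrC mulr_natl mulrb [u _ _ * _]mulrC.
have S_sym : S = \sum_x \sum_(y | adj x y) (f y * f y + f y * f x).
  rewrite /S (exchange_big_dep xpredT) //=.
  by apply: eq_bigr => y _; apply: eq_bigl => x; rewrite adj_sym.
rewrite edge_energyE mulr_natl mulr2n {2}S_sym -big_split /=.
apply: eq_bigr => x _; rewrite -big_split /=.
by apply: eq_bigr => y _; ring.
Qed.

Lemma trmx_signless_laplacian : (signless_laplacian R G)^T = signless_laplacian R G.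
Proof.
rewrite /signless_laplacian raddfD /= tr_diag_mx; congr (_ + _).
by apply/matrixP => i j; rewrite !mxE adj_sym.
Qed.

(** * Energy along paths *)

(* The alternating sum of the values [f u + f v] over the edges of the path
   telescopes, and Cauchy-Schwarz applies to it. *)
Lemma alternating_path_energy f x p : path (@adj G) x p -> uniq (x :: p) ->
  (f x - (-1) ^+ size p * f (last x p)) ^+ 2 <=
  (size p)%:R * \sum_(S in edges G | S \subset x :: p) `|\sum_(z in S) f z| ^+ 2.
Proof.
elim: p x => [x _ _|y p IH x /= /andP[xy yp] /andP[xyp Uyp]].
  by rewrite expr0 mul1r subrr expr0n mul0r.
have xyE : [set x; y]%SET \in edges G by apply/edgesP; exists (x, y).
have := IH y yp Uyp.
set b := f y - _; set E := \sum_(S in edges G | _) _ => bE.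
have E0 : 0 <= E by apply: sumr_ge0 => S _; exact: sqr_ge0.
have -> : f x - (-1) ^+ (size p).+1 * f (last y p) = f x + f y - b.
  by rewrite /b exprS; ring.
set a := f x + f y.
set E' := \sum_(S in _ | _) _.
have EE' : a ^+ 2 + E <= E'.
  rewrite /E' (bigD1 [set x; y]%SET) /=; last first.
    by rewrite xyE; apply/fintype.subsetP => z; rewrite !inE => /orP[]/eqP->; rewrite eqxx ?orbT.
  rewrite sum_edge// real_normK ?num_real// lerD2l.
  rewrite /E big_mkcond [leRHS]big_mkcond /=; apply: ler_sum => S _.
  case: ifP => [/andP[-> Sp]|_]; last by case: ifP => _ //; exact: sqr_ge0.
  rewrite (fintype.subset_trans Sp) /=; last first.
    by apply/fintype.subsetP => z; rewrite [in X in _ -> X]inE => ->; rewrite orbT.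
  (* The edge [xy] is not counted in [E], since [x] is not on the rest of the path. *)
  case: eqP => // SE; case/negP: xyp.
  by apply: (fintype.subsetP Sp); rewrite SE !inE eqxx.
apply: (@le_trans _ _ ((size p).+1%:R * (a ^+ 2 + E))); last by rewrite ler_wpM2l ?ler0n.
rewrite -natr1; have [n0|n0] := eqVneq (size p) 0%N.
  have b0 : b = 0.
    by apply/eqP; rewrite -sqrf_eq0 eq_le sqr_ge0 andbT; move: bE; rewrite n0 mul0r.
  by rewrite n0 b0 subr0 add0r mul1r lerDl.
have n_gt0 : 0 < (size p)%:R :> R by rewrite ltr0n lt0n.
set n : R := (size p)%:R in bE n_gt0 *.
rewrite -(ler_pM2l n_gt0) -subr_ge0.
(* The identity behind [(a - b) ^ 2 <= (n + 1) * (a ^ 2 + b ^ 2 / n)], used with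
   [b ^ 2 <= n * E]. *)
have -> : n * ((n + 1) * (a ^+ 2 + E)) - n * (a - b) ^+ 2 =
  (n * a + b) ^+ 2 + (n + 1) * (n * E - b ^+ 2) by ring.
by rewrite addr_ge0 ?sqr_ge0// mulr_ge0 ?subr_ge0//; lra.
Qed.

Lemma path_energy_le f x p : path (@adj G) x p -> uniq (x :: p) ->
  (f x - (-1) ^+ size p * f (last x p)) ^+ 2 <= (size p)%:R * edge_energy f.
Proof.
move=> xp Up; apply: le_trans (alternating_path_energy f xp Up) _.
rewrite ler_wpM2l ?ler0n// /edge_energy [leRHS](bigID (fun S : {set G} => S \subset x :: p)) /=.
by rewrite lerDl; apply: sumr_ge0 => S _; exact: sqr_ge0.
Qed.

(* With [y], [z] adjacent and both at distance [d] from [x], put [t = (-1)^d f z].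
   The path x..y,z of length [d + 1] gives energy at least [(f x + t)^2 / (d + 1)],
   the path x..z of length [d] gives at least [(f x - t)^2 / d]; one of these
   squares is at least [f x ^ 2]. *)
Lemma edge_energy_ge f x : connected_graph G -> ~ bipartite G ->
  f x ^+ 2 <= ((diam G)%:R + 1) * edge_energy f.
Proof.
move=> conn nbip; have [y [z [yz dyz]]] := nonbipartite_equidistant_edge x conn nbip.
have [p [xp lastp Up sp]] := shortest_path (conn x y).
have [q [xq lastq Uq sq]] := shortest_path (conn x z).
have dG : (dist x y)%:R <= (diam G)%:R :> R by rewrite ler_nat dist_le_diam.
have E0 := edge_energy_ge0 f.
(* If the shortest path to [y] met [z], its part up to [z] would already have the full length,
   forcing [z = y]. *)
have z_notin : z \notin x :: p.
  apply/negP => zp; move: xp lastp sp.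
  case/splitPl: zp => p1 p2 lastp1.
  rewrite cat_path last_cat size_cat lastp1 => /andP[xp1 _] lastp2 sp.
  have := dist_le_size xp1; rewrite lastp1 -dyz -sp.
  case: p2 lastp2 {sp} => [zE _|? ? _]; last by rewrite addnS ltnNge leq_addr.
  by move: (adj_neq yz); rewrite -zE eqxx.
have := path_energy_le f xq Uq.
have := @path_energy_le f x (rcons p z).
rewrite rcons_path xp lastp yz -rcons_cons rcons_uniq z_notin Up => /(_ isT isT).
rewrite last_rcons size_rcons lastq sq sp -dyz [(-1) ^+ _.+1]exprS -mulrA mulN1r opprK -natr1.
set t := (-1) ^+ _ * f z => yB zB.
have [xt|xt] := leP 0 (f x * t).
  apply: (@le_trans _ _ ((f x + t) ^+ 2)); first by have := sqr_ge0 t; lra.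
  by apply: le_trans yB _; rewrite ler_wpM2r// lerD2r.
apply: (@le_trans _ _ ((f x - t) ^+ 2)); first by have := sqr_ge0 t; lra.
by apply: le_trans zB _; rewrite ler_wpM2r//; lra.
Qed.

(** * Bounds on [scrK] and by [scrK] *)

Lemma scrK_ge : connected_graph G -> ~ bipartite G ->
  ((diam G)%:R + 1)^-1 <= scrK R G.
Proof.
move=> conn nbip; have [f /sign_changingP[[x0 fx0] _] <-] := @scrK_attained R G conn nbip.
have [|x fx [-> _]] := @max_sqr_attained R G f; first by exists x0; rewrite lt_eqF.
have d0 : 0 < (diam G)%:R + 1 :> R by rewrite natr1 ltr0n.
rewrite ler_pdivlMr ?exprn_gt0 ?normr_gt0// mulrC ler_pdivrMr// mulrC.
by rewrite real_normK ?num_real//; exact: edge_energy_ge.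
Qed.

Lemma scrK_le_sign_changing f x : sign_changing f ->
  scrK R G * `|f x| ^+ 2 <= edge_energy f.
Proof.
move=> fs; have /sign_changingP[[y fy] _] := fs.
have ms_gt0 : 0 < max_sqr f.
  by apply: lt_le_trans (max_sqr_ge f y); rewrite exprn_gt0// normr_gt0 lt_eqF.
have lb : has_lbound [set edge_energy g / max_sqr g | g in @sign_changing R G]%classic.
  exists 0 => _ [g _ <-]; rewrite divr_ge0 ?edge_energy_ge0//.
  exact: le_trans (sqr_ge0 _) (max_sqr_ge g x).
have K0 : 0 <= scrK R G.
  apply: lb_le_inf => [|_ [g _ <-]]; first by exists (edge_energy f / max_sqr f), f.
  rewrite divr_ge0 ?edge_energy_ge0//.
  exact: le_trans (sqr_ge0 _) (max_sqr_ge g x).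
apply: (@le_trans _ _ (scrK R G * max_sqr f)); first by rewrite ler_wpM2l// max_sqr_ge.
by rewrite -ler_pdivlMr//; apply: ge_inf => //; exists f.
Qed.

(** Supplies the edge that [sign_changing_improve] needs: the first step of a path to some edge, or
    that edge itself. *)
Lemma exists_neighbour x : connected_graph G -> ~ bipartite G -> exists y, adj x y.
Proof.
move=> conn nbip; have [y [z [yz _]]] := nonbipartite_equidistant_edge x conn nbip.
have /connectP[[|w p] /=] := conn x y; first by move=> _ yE; exists z; rewrite -yE.
by case/andP => xw; exists w.
Qed.

(* A function that does not change sign is no competitor for the minimum:
   [sign_changing_improve] turns it into one that does, without raising the quotient. *)
Lemma scrK_le f x : connected_graph G -> ~ bipartite G ->
  scrK R G * f x ^+ 2 <= edge_energy f.
Proof.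
move=> conn nbip.
have K0 : 0 <= scrK R G by rewrite (le_trans _ (scrK_ge conn nbip))// invr_ge0 natr1.
have [fs|nfs] := pselect (sign_changing f).
  by rewrite -[f x ^+ 2]real_normK ?num_real//; exact: scrK_le_sign_changing.
have [fx0|fx0] := eqVneq (f x) 0; first by rewrite fx0 expr0n mulr0 edge_energy_ge0.
have [|i fi [_ fmax]] := @max_sqr_attained R G f; first by exists x.
(* Dividing by the value of largest modulus gives [h i = 1]; as [f] does not change sign, [h] takes
   values in [[0, 1]]. *)
pose h y := (f i)^-1 * f y.
have hi : h i = 1 by rewrite /h mulVf.
have h_le1 y : `|h y| <= 1.
  by rewrite /h normrM normfV mulrC ler_pdivrMr ?normr_gt0// mul1r.
have h_ge0 y : 0 <= h y.
  rewrite leNgt; apply/negP => hy; apply: nfs; apply/sign_changingP.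
  have [fi0|fi0|fiE] := ltgtP (f i) 0; last by rewrite fiE eqxx in fi.
    by split; [exists i|exists y; move: hy; rewrite /h nmulr_rlt0 ?invr_lt0].
  by split; [exists y; move: hy; rewrite /h pmulr_rlt0 ?invr_gt0|exists i].
have h01 y : 0 <= h y <= 1 by rewrite h_ge0 (le_trans (ler_norm _)).
have [j ij] := exists_neighbour i conn nbip.
have [g gs [gi [_ gh]]] := sign_changing_improve ij hi h01.
have := le_trans (scrK_le_sign_changing i gs) gh.
rewrite gi normr1 expr1n mulr1 /h edge_energyZ exprVn mulrC ler_pdivlMr ?exprn_even_gt0//.
apply: le_trans; rewrite ler_wpM2l//.
rewrite -[f x ^+ 2]real_normK ?num_real// -[f i ^+ 2]real_normK ?num_real//.
by rewrite lerXn2r ?nnegrE.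
Qed.

End Graph.

Theorem corollary1p10 (R : realType) (G : sgraph)
    (G_connected : connected_graph G) (G_nonbipartite : ~ bipartite G)
    (lam : #|G|.-tuple R)
    (lam_spectrum : ordered_spectrum (signless_laplacian R G) lam)
    (k : nat) (k_range : (1 <= k <= #|G|)%N) :
  lam`_k.-1 >= k%:R * scrK R G / #|G|%:R /\
  k%:R * scrK R G / #|G|%:R >= k%:R / (((diam G)%:R + 1) * #|G|%:R).
Proof.
have /andP[k0 _] := k_range.
have n0 : 0 < #|G|%:R :> R by rewrite ltr0n; case/andP: k_range; exact: leq_trans.
split; last first.
  rewrite invfM mulrA ler_wpM2r ?invr_ge0 ?ler0n// ler_wpM2l ?ler0n//.
  exact: scrK_ge.
have [v [x [y [xv_ge form_le]]]] :=
  spectral_projection_row (trmx_signless_laplacian G R) lam_spectrum k_range.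
have xv_gt0 : 0 < x 0 v.
  by rewrite -(pmulr_rgt0 _ n0); apply: lt_le_trans xv_ge; rewrite ltr0n.
have K0 : 0 <= scrK R G.
  by apply: le_trans (scrK_ge R G_connected G_nonbipartite); rewrite invr_ge0 natr1.
move: form_le; rewrite !signless_laplacian_form => form_le.
have := scrK_le (fun z => x 0 (enum_rank z)) (enum_val v) G_connected G_nonbipartite.
rewrite enum_valK => Kx_le.
(* Dropping the nonnegative energy of [y] leaves an inequality between multiples of [x 0 v], which
   is positive and cancels. *)
have : scrK R G * x 0 v <= lam`_k.-1.
  rewrite -(ler_pM2r xv_gt0) -mulrA -expr2; apply: le_trans Kx_le _.
  by apply: le_trans form_le; rewrite lerDl edge_energy_ge0.
rewrite -(ler_pM2r n0) ler_pdivrMr// => /(le_trans _); apply.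
by rewrite mulrC -mulrA ler_wpM2l// mulrC.
Qed.
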